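(* Let $\bar M^{2m+1}(\phi,\xi,\eta,g)$ be a Lorentzian paracosymplectic manifold. Then there does not exist a non-trivial pointwise semi-slant warped product submanifold of the form $M=M_\theta\times_fM_T$ of $\bar M^{2m+1}$ such that the structure vector field $\xi$ is tangent to $M_T$.
   Context: A Lorentzian almost paracontact manifold $\bar M^{2m+1}(\phi,\xi,\eta,g)$ is a smooth $(2m+1)$-manifold with a $(1,1)$-tensor $\phi$, a vector field $\xi$, a $1$-form $\eta$ and a Lorentzian metric $g$ such that $\phi^2=I+\eta\otimes\xi$, $\eta(\xi)=-1$, $\phi\xi=0$, $\eta\circ\phi=0$, $\mathrm{rank}(\phi)=2m$, $g(\phi X,\phi Y)=g(X,Y)+\eta(X)\eta(Y)$; then $g(\xi,\xi)=-1$, $g(X,\xi)=\eta(X)$ and $g(\phi X,Y)=g(X,\phi Y)$. It is Lorentzian paracosymplectic if $\bar\nabla\eta=0$ and $\bar\nabla\Phi=0$, where $\bar\nabla$ is the Levi-Civita connection and $\Phi(X,Y)=g(X,\phi Y)$. Submanifolds $M$ are assumed to have non-degenerate induced metric, also denoted $g$. For $X$ tangent to $M$ write $\phi X=tX+nX$ with $tX$ tangent and $nX$ normal to $M$. Pointwise slant: a submanifold or distribution is pointwise slant if at each point $p$ the angle $\theta$ between $\phi X$ and the tangent space (resp. the distribution) does not depend on the non-zero vector $X$ (linearly independent of $\xi$) chosen at $p$; $\theta$, viewed as a function, is the slant function. For a distribution $\mathfrak D_\theta$ with orthogonal projection $P_\theta$ onto it, this is characterized by $(tP_\theta)^2Z=\cos^2\theta\,Z$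 for $Z\in\Gamma(\mathfrak D_\theta)$. A point is totally real if $\cos\theta=0$ there; a pointwise slant submanifold is pointwise proper slant if it contains no totally real points. A submanifold $M$ is pointwise semi-slant if $TM=\mathfrak D_T\oplus\mathfrak D_\theta\oplus\{\xi\}$ (orthogonal direct sum, $\{\xi\}$ the line distribution spanned by $\xi$, so $\xi$ is tangent to $M$) with $\phi(\mathfrak D_T)\subseteq\mathfrak D_T$ and $\mathfrak D_\theta$ pointwise slant with slant function $\theta$. The warped product $B\times_fF$ of pseudo-Riemannian manifolds $(B,g_B)$, $(F,g_F)$ with positive smooth warping function $f$ on $B$ is $B\times F$ with metric $g=g_B+f^2g_F$; it is trivial if $f$ is constant. A (non-trivial) pointwise semi-slant warped product submanifold $M_\theta\times_fM_T$ is a pointwise semi-slant submanifold that is a warped product of this form with $f$ non-constant on the first factor, where $M_T$ is an invariant integral submanifold of $\mathfrak D_T$ and $M_\theta$ is a pointwise proper slant integral submanifold of $\mathfrak D_\theta$. When $\xi$ is tangent to $M_T$, $M_T$ is an integral submanifold of $\mathfrak D_T\oplus\{\xi\}$.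
   Formalization: The first factor M_θ is assumed connected (and manifolds non-empty), as is conventional; for disconnected M_θ the claim as worded fails, since f may be a different constant on each component. *)

(* Defs.v *)
From HB Require Import structures.
From mathcomp Require Import all_boot all_order all_algebra.
From mathcomp Require Import all_classical all_reals all_analysis.

Set Implicit Arguments.
Unset Strict Implicit.
Unset Printing Implicit Defensive.

Import Order.TTheory GRing.Theory Num.Theory.
Import numFieldNormedType.Exports.

Local Open Scope classical_set_scope.
Local Open Scope ring_scope.

Section SmoothFunctions.
Context {R : realType}.

Fixpoint Ck n (V : normedModType R) (k : nat) (U : set 'rV[R]_n)
    (f : 'rV[R]_n -> V) : Prop :=
  if k is k'.+1 then
    (forall x, U x -> differentiable f x) /\
    (forall v, Ck k' U (fun x => 'D_v f x))
  else forall x, U x -> {for x, continuous f}.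

(* C^oo on U; only used for open U *)
Definition smooth n (V : normedModType R) (U : set 'rV[R]_n)
  (f : 'rV[R]_n -> V) : Prop := forall k, Ck k U f.

Lemma near_eq_differentiable (V W : normedModType R) (f g : V -> W) x :
  (\forall y \near x, f y = g y) -> differentiable f x -> differentiable g x.
Proof.
move=> fg df.
suff dh : differentiable (g - f) x.
  by rewrite -(subrK f g); exact: differentiableD.
pose Z : {linear V -> W} := \0.
have Zc : continuous Z by move=> y; exact: cvg_cst.
have gfx : (g - f) x = 0.
  by rewrite -[LHS]/(g x - f x) (nbhs_singleton fg) subrr.
have E : (g - f) \o shift x = cst ((g - f) x) + Z +o_ 0 id.
  apply/eqaddoP => e e0; near=> h.
  suff gfh : g (h + x) = f (h + x).
    have -> : ((g - f) \o shift x - (cst ((g - f) x) + Z)) h = 0.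
      rewrite -[LHS]/((g (h + x) - f (h + x)) - ((g - f) x + 0)) gfx gfh.
      by rewrite subrr add0r addr0 oppr0.
    by rewrite normr0 mulr_ge0// ltW.
  apply/esym; near: h.
  by move: fg; rewrite (near_shift 0) subr0.
by apply/diff_locallyP; rewrite (diff_unique Zc E).
Unshelve. all: by end_near. Qed.

Lemma Ck_ext n (V : normedModType R) k (U : set 'rV[R]_n)
  (f g : 'rV[R]_n -> V) :
  open U -> (forall x, U x -> f x = g x) -> Ck k U f -> Ck k U g.
Proof.
move=> oU; have nU h1 h2 x : (forall y, U y -> h1 y = h2 y :> V) -> U x ->
    \forall y \near x, h1 y = h2 y.
  move=> h12 Ux; have := open_nbhs_nbhs (conj oU Ux).
  by apply: filterS => y; exact: h12.
elim: k f g => [|k IH] f g fg /=.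
  move=> cf x Ux; rewrite /prop_for /continuous_at -(fg x Ux).
  apply: cvg_trans (cf x Ux); apply: near_eq_cvg.
    exact: (@nbhs_filter _ x).
  exact: nU fg Ux.
move=> [df Df]; split=> [x Ux|v].
  by apply: near_eq_differentiable (df x Ux); exact: nU fg Ux.
apply: (IH _ _ _ (Df v)) => x Ux; apply: near_eq_derive; exact: nU fg Ux.
Qed.

Lemma CkD n (V : normedModType R) k (U : set 'rV[R]_n) (f g : 'rV[R]_n -> V) :
  open U -> Ck k U f -> Ck k U g -> Ck k U (f \+ g).
Proof.
move=> oU; elim: k f g => [|k IH] f g /=.
  by move=> cf cg x Ux; apply: continuousD; [exact: cf|exact: cg].
move=> [df Df] [dg Dg]; split=> [x Ux|v].
  by apply: differentiableD; [exact: df|exact: dg].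
apply: (Ck_ext oU _ (IH _ _ (Df v) (Dg v))) => x Ux /=.
by rewrite -[f \+ g]/(f + g) deriveD//; apply: diff_derivable; auto.
Qed.

Lemma mulmxr_continuous n p (A : 'M[R]_(n, p)) :
  continuous (mulmxr A : 'rV[R]_n -> 'rV[R]_p).
Proof.
move=> x; apply: differentiable_continuous.
rewrite (_ : (mulmxr A : _ -> _) =
    \sum_i (fun y : 'rV[R]_n => y 0 i *: row i A)); last first.
  by apply/funext => y /=; rewrite fct_sumE mulmx_sum_row.
apply: differentiable_sum => i.
by apply: differentiableZl; exact: differentiable_coord.
Qed.

Lemma Ck_mulmx n n' p p' k (A : 'M[R]_(n', n)) (B : 'M[R]_(p, p'))
  (U : set 'rV[R]_n) (f : 'rV[R]_n -> 'rV[R]_p) :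
  open U -> Ck k U f ->
  Ck k (mulmxr A @^-1` U) (fun x : 'rV[R]_n' => f (x *m A) *m B).
Proof.
move=> oU.
have oAU : open (mulmxr A @^-1` U : set 'rV[R]_n').
  by apply: open_comp => // x _; exact: mulmxr_continuous.
have dl n1 n2 (C : 'M[R]_(n1, n2)) x : differentiable (mulmxr C : 'rV[R]_n1 -> 'rV[R]_n2) x.
  exact/linear_differentiable/mulmxr_continuous.
elim: k f => [|k IH] f /=.
  move=> cf x Ux; apply: (@continuous_comp _ _ _ (f \o mulmxr A) (mulmxr B)).
    apply: continuous_comp; [exact: mulmxr_continuous|exact: cf].
  exact: mulmxr_continuous.
move=> [df Df]; have dfA x : U (x *m A) -> differentiable (f \o mulmxr A) x.
  by move=> Ux; apply: differentiable_comp => //; exact: df.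
split=> [x Ux|v].
  apply: (@differentiable_comp _ _ _ _ (f \o mulmxr A) (mulmxr B)) => //.
  exact: dfA.
apply: (Ck_ext oAU _ (IH _ (Df (v *m A)))) => x /= Ux.
have E : 'd (mulmxr B \o (f \o mulmxr A)) x =
    mulmxr B \o ('d f (x *m A) \o mulmxr A) :> (_ -> _).
  rewrite (diff_comp (dfA _ Ux) (dl _ _ B _)) (diff_comp (dl _ _ A x) (df _ Ux)).
  by rewrite !diff_lin//; exact: mulmxr_continuous.
rewrite deriveE; last exact: df.
rewrite -[RHS]/('D_v (mulmxr B \o (f \o mulmxr A)) x) deriveE ?E//.
by apply: differentiable_comp => //; exact: dfA.
Qed.

End SmoothFunctions.

Section Manifolds.
Context {R : realType}.

(* chart_inv is only meaningful on the image of chart_dom *)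
Record chart n (T : topologicalType) := Chart {
  chart_dom : set T;
  chart_fun :> T -> 'rV[R]_n;
  chart_inv : 'rV[R]_n -> T;
  chart_dom_open : open chart_dom;
  chart_img_open : open (chart_fun @` chart_dom);
  chart_funK : forall p, chart_dom p -> chart_inv (chart_fun p) = p;
  chart_fun_cont : forall p, chart_dom p -> {for p, continuous chart_fun};
  chart_inv_cont : forall p, chart_dom p ->
    {for chart_fun p, continuous chart_inv}
}.

(* The choice of a chart around each point identifies every tangent space
   T_pM with 'rV_n, by means of the coordinates in chart_at p: below, a vector
   field is a function X : M -> 'rV_n whose value X p is read in chart_at p.
   The identification varies from point to point, so the smoothness of X has to
   be tested after moving X p to a fixed chart (see vfield_smooth). *)
Record manifold n := Manifold {
  mfd_space :> topologicalType;
  atlas : set (chart n mfd_space);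
  chart_at : mfd_space -> chart n mfd_space;
  atlas_chart_at : forall p, atlas (chart_at p);
  chart_at_dom : forall p, chart_dom (chart_at p) p;
  atlas_compat : forall c c', atlas c -> atlas c' ->
    smooth (c @` (chart_dom c `&` chart_dom c')) (c' \o chart_inv c);
  mfd_nonempty : [set: mfd_space] !=set0;
  mfd_hausdorff : hausdorff_space mfd_space;
  mfd_second_countable : @second_countable mfd_space
}.

Section Product.

Lemma open_setX (T T' : topologicalType) (A : set T) (B : set T') :
  open A -> open B -> open (A `*` B).
Proof.
move=> oA oB; rewrite openE => -[x y] [/= Ax By].
by exists (A, B) => //; split; exact: open_nbhs_nbhs.
Qed.

Section ProductChart.
Context n n' (T T' : topologicalType) (c : chart n T) (c' : chart n' T').

Let dom : set (T * T') := chart_dom c `*` chart_dom c'.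
Let F (z : T * T') : 'rV[R]_(n + n') := row_mx (c z.1) (c' z.2).
Let G (x : 'rV[R]_(n + n')) := (chart_inv c (lsubmx x), chart_inv c' (rsubmx x)).

Lemma prod_chart_img : F @` dom =
  (lsubmx @^-1` (c @` chart_dom c)) `&` (rsubmx @^-1` (c' @` chart_dom c')).
Proof.
apply/seteqP; split=> [_ [[p q] [/= dp dq] <-]|x [[p dp ep] [q dq eq]]].
  by split; [exists p|exists q] => //; rewrite /F /= ?row_mxKl ?row_mxKr.
by exists (p, q) => //; rewrite /F /= ep eq hsubmxK.
Qed.

Fact prod_chart_dom_open : open dom.
Proof. by apply: open_setX; exact: chart_dom_open. Qed.

Fact prod_chart_img_open : open (F @` dom).
Proof.
rewrite prod_chart_img; apply: openI; apply: open_comp;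
  by [move=> x _; exact: continuous_lsubmx|
      move=> x _; exact: continuous_rsubmx|exact: chart_img_open].
Qed.

Fact prod_chart_funK p : dom p -> G (F p) = p.
Proof.
by case: p => p q [/= dp dq]; rewrite /G /F /= row_mxKl row_mxKr !chart_funK.
Qed.

Fact prod_chart_fun_cont p : dom p -> {for p, continuous F}.
Proof.
case: p => p q [/= dp dq].
have -> : F = (fun z => c z.1 *m row_mx 1%:M 0 + c' z.2 *m row_mx 0 1%:M).
  apply/funext => z; rewrite /F !mul_mx_row !mulmx1 !mulmx0.
  by rewrite add_row_mx addr0 add0r.
apply: continuousD.
- apply: (@continuous_comp _ _ _ (c \o fst) (mulmxr _)).
    by apply: continuous_comp; [exact: cvg_fst|exact: chart_fun_cont].
  exact: mulmxr_continuous.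
- apply: (@continuous_comp _ _ _ (c' \o snd) (mulmxr _)).
    by apply: continuous_comp; [exact: cvg_snd|exact: chart_fun_cont].
  exact: mulmxr_continuous.
Qed.

Fact prod_chart_inv_cont p : dom p -> {for F p, continuous G}.
Proof.
case: p => p q [/= dp dq].
have cl : {for F (p, q), continuous (chart_inv c \o lsubmx)}.
  apply: continuous_comp; first exact: continuous_lsubmx.
  by rewrite /F row_mxKl; exact: chart_inv_cont.
have cr : {for F (p, q), continuous (chart_inv c' \o rsubmx)}.
  apply: continuous_comp; first exact: continuous_rsubmx.
  by rewrite /F row_mxKr; exact: chart_inv_cont.
exact: (cvg_pair cl cr).
Qed.

Definition prod_chart : chart (n + n') (T * T')%type :=
  Chart prod_chart_dom_open prod_chart_img_open prod_chart_funK
    prod_chart_fun_cont prod_chart_inv_cont.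

End ProductChart.

Context n n' (B : manifold n) (F : manifold n').

Definition prod_atlas : set (chart (n + n') (B * F)%type) :=
  [set prod_chart c.1 c.2 | c in @atlas _ B `*` @atlas _ F].

Definition prod_chart_at (p : B * F) := prod_chart (chart_at p.1) (chart_at p.2).

Fact prod_atlas_chart_at p : prod_atlas (prod_chart_at p).
Proof.
by exists (chart_at p.1, chart_at p.2) => //; split; exact: atlas_chart_at.
Qed.

Fact prod_chart_at_dom p : chart_dom (prod_chart_at p) p.
Proof. by split; exact: chart_at_dom. Qed.

Fact prod_atlas_compat c c' : prod_atlas c -> prod_atlas c' ->
  smooth (c @` (chart_dom c `&` chart_dom c')) (c' \o chart_inv c).
Proof.
move=> [[c1 c2] /= [A1 A2] <-] [[c1' c2'] /= [A1' A2'] <-] k.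
set U1 := c1 @` (chart_dom c1 `&` chart_dom c1').
set U2 := c2 @` (chart_dom c2 `&` chart_dom c2').
have oU m (T : topologicalType) (d d' : chart m T) :
    open (d @` (chart_dom d `&` chart_dom d')).
  rewrite (_ : _ @` _ = d @` chart_dom d `&`
      (chart_inv d @^-1` chart_dom d')); last first.
    apply/seteqP; split=> [_ [p [dp dp'] <-]|x [[p dp <-] /=]].
      by split; [exists p|rewrite /= chart_funK].
    by rewrite chart_funK// => dp'; exists p.
  rewrite openE => x [[p dp <-] dp']; apply: filterI.
    by apply: open_nbhs_nbhs; split; [exact: chart_img_open|exists p].
  apply: (chart_inv_cont dp); apply: open_nbhs_nbhs.
  by split; [exact: chart_dom_open|].
pose L : 'M[R]_(n + n', n) := col_mx 1%:M 0.
pose L' : 'M[R]_(n + n', n') := col_mx 0 1%:M.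
have LE (x : 'rV[R]_(n + n')) : x *m L = lsubmx x.
  by rewrite -{1}(hsubmxK x) mul_row_col mulmx1 mulmx0 addr0.
have LE' (x : 'rV[R]_(n + n')) : x *m L' = rsubmx x.
  by rewrite -{1}(hsubmxK x) mul_row_col mulmx1 mulmx0 add0r.
have C1 := Ck_mulmx L (row_mx 1%:M (0 : 'M[R]_(n, n'))) (oU _ _ c1 c1')
  (atlas_compat A1 A1' k).
have C2 := Ck_mulmx L' (row_mx (0 : 'M[R]_(n', n)) 1%:M) (oU _ _ c2 c2')
  (atlas_compat A2 A2' k).
rewrite -/U1 -/U2 in C1 C2.
have sub m (V : normedModType R) (W W' : set 'rV[R]_m) (f : 'rV[R]_m -> V) :
    W' `<=` W -> Ck k W f -> Ck k W' f.
  move=> WW'; elim: k f {C1 C2} => [|k IH] f /=; first by move=> + x /WW'; exact.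
  by move=> [df Df]; split=> [x /WW'|v]; [exact: df|exact: IH].
have sU (x : 'rV[R]_(n + n')) : (prod_chart c1 c2 @`
    (chart_dom (prod_chart c1 c2) `&` chart_dom (prod_chart c1' c2'))) x ->
    U1 (x *m L) /\ U2 (x *m L').
  move=> [[p q] [[/= d1 d2] [/= d1' d2']] <-]; rewrite LE LE' row_mxKl row_mxKr.
  by split; [exists p|exists q].
have H := CkD (oU _ _ (prod_chart c1 c2) (prod_chart c1' c2'))
  (sub _ _ _ _ _ (fun x h => (sU x h).1) C1)
  (sub _ _ _ _ _ (fun x h => (sU x h).2) C2).
apply: (Ck_ext (oU _ _ _ _) _ H) => x _ /=.
by rewrite LE LE' !mul_mx_row !mulmx1 !mulmx0 add_row_mx addr0 add0r.
Qed.

Fact prod_mfd_nonempty : [set: B * F] !=set0.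
Proof.
by have [[p _] [q _]] := (mfd_nonempty B, mfd_nonempty F); exists (p, q).
Qed.

Fact prod_mfd_hausdorff : hausdorff_space (B * F)%type.
Proof.
move=> [p q] [p' q'] H; congr pair.
- apply: mfd_hausdorff => A A' nA nA'.
  have := H (A `*` setT) (A' `*` setT).
  case; [by exists (A, setT) => //; split => //; exact: filterT|
         by exists (A', setT) => //; split => //; exact: filterT|].
  by move=> [x y] [[/= Ax _] [/= A'x _]]; exists x.
- apply: mfd_hausdorff => A A' nA nA'.
  have := H (setT `*` A) (setT `*` A').
  case; [by exists (setT, A) => //; split => //; exact: filterT|
         by exists (setT, A') => //; split => //; exact: filterT|].
  by move=> [x y] [[/= _ Ax] [/= _ A'x]]; exists y.
Qed.

Fact prod_mfd_second_countable : @second_countable (B * F)%type.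
Proof.
have [[X cX [oX bX]] [Y cY [oY bY]]] :=
  (mfd_second_countable B, mfd_second_countable F).
exists [set Z.1 `*` Z.2 | Z in X `*` Y].
  apply: (card_le_trans (card_image_le _ _)).
  exact: countableX.
split=> [_ [[U V] [/= XU YV] <-]|[p q] Z [[U V] [/= /bX nU /bY nV] UVZ]].
  by apply: open_setX; [exact: oX|exact: oY].
have [U' /= [XU' U'p] U'U] := nU; have [V' /= [YV' V'q] V'V] := nV.
exists (U' `*` V'); first by split=> //; exists (U', V').
by apply: subset_trans UVZ => -[x y] [/= /U'U ? /V'V ?].
Qed.

Definition prod_manifold : manifold (n + n') :=
  Manifold prod_atlas_chart_at prod_chart_at_dom prod_atlas_compat
    prod_mfd_nonempty prod_mfd_hausdorff prod_mfd_second_countable.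

End Product.

(* row vectors: the differential sends u to u *m dmap F p *)
Definition dmap n n' (M : manifold n) (N : manifold n') (F : M -> N) (p : M) :
    'M[R]_(n, n') :=
  'J (chart_at (F p) \o F \o chart_inv (chart_at p)) (chart_at p p).

Definition smooth_map n n' (M : manifold n) (N : manifold n') (F : M -> N) :=
  continuous F /\
  forall c c', atlas c -> atlas c' ->
    smooth (c @` (chart_dom c `&` F @^-1` chart_dom c'))
      (c' \o F \o chart_inv c).

Definition immersion n n' (M : manifold n) (N : manifold n') (F : M -> N) :=
  smooth_map F /\ forall p, row_free (dmap F p).

Section Tensors.
Context n (M : manifold n).

Definition fun_smooth (U : set M) (f : M -> R) :=
  forall c, atlas c ->
    smooth (V := R^o) (c @` (chart_dom c `&` U)) (f \o chart_inv c).

(* the derivative u(f) of f along the tangent vector u at p *)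
Definition vderive (f : M -> R) (p : M) (u : 'rV[R]_n) : R :=
  'D_u (f \o chart_inv (chart_at p) : 'rV[R]_n -> R^o) (chart_at p p).

(* change of coordinates T_pM -> 'rV_n, from chart_at p to c *)
Definition tangent_coord (c : chart n M) (p : M) : 'M[R]_n :=
  'J (c \o chart_inv (chart_at p)) (chart_at p p).

Definition vfield_smooth (U : set M) (X : M -> 'rV[R]_n) :=
  forall c, atlas c ->
    smooth (c @` (chart_dom c `&` U))
      (fun x => X (chart_inv c x) *m tangent_coord c (chart_inv c x)).

(* Tensors are families of matrices acting on row vectors:
   eta_p(u) = u *m eta p, phi_p(u) = u *m phi p, g_p(u, v) = u *m g p *m v^T.
   They are smooth when they send smooth local vector fields to smooth
   objects. *)
Definition form_app (eta : M -> 'cV[R]_n) (p : M) (u : 'rV[R]_n) : R :=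
  (u *m eta p) 0 0.

Definition bil_app (g : M -> 'M[R]_n) (p : M) (u v : 'rV[R]_n) : R :=
  (u *m g p *m v^T) 0 0.

Definition form_smooth (eta : M -> 'cV[R]_n) := forall (U : set M) X,
  open U -> vfield_smooth U X -> fun_smooth U (fun p => form_app eta p (X p)).

Definition endo_smooth (phi : M -> 'M[R]_n) := forall (U : set M) X,
  open U -> vfield_smooth U X -> vfield_smooth U (fun p => X p *m phi p).

Definition bil_smooth (g : M -> 'M[R]_n) := forall (U : set M) X Y,
  open U -> vfield_smooth U X -> vfield_smooth U Y ->
  fun_smooth U (fun p => bil_app g p (X p) (Y p)).

(* nu is the number of minus signs in the signature *)
Definition has_index (nu : nat) (G : 'M[R]_n) : Prop :=
  exists2 A : 'M[R]_n, A \in unitmx &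
    A *m G *m A^T = diag_mx (\row_j (if (j < nu)%N then -1 else 1)).

Definition metric_of_index (nu : nat) (g : M -> 'M[R]_n) :=
  [/\ bil_smooth g, forall p, (g p)^T = g p & forall p, has_index nu (g p)].

Definition pseudo_riemannian (g : M -> 'M[R]_n) :=
  exists2 nu, (nu <= n)%N & metric_of_index nu g.

Definition lorentzian (g : M -> 'M[R]_n) := metric_of_index 1 g.

(* nabla Y p u is the derivative of Y at p along u in T_pM, for every vector
   field Y smooth on some neighbourhood of p *)
Record is_connection (nabla : (M -> 'rV[R]_n) -> M -> 'rV[R]_n -> 'rV[R]_n) :
    Prop := {
  conn_linear : forall (U : set M) Y p, open U -> U p -> vfield_smooth U Y ->
    linear (nabla Y p);
  connD : forall (U : set M) Y Z p u, open U -> U p ->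
    vfield_smooth U Y -> vfield_smooth U Z ->
    nabla (fun q => Y q + Z q) p u = nabla Y p u + nabla Z p u;
  conn_leibniz : forall (U : set M) f Y p u, open U -> U p ->
    fun_smooth U f -> vfield_smooth U Y ->
    nabla (fun q => f q *: Y q) p u =
      vderive f p u *: Y p + f p *: nabla Y p u;
  conn_smooth : forall (U : set M) X Y, open U ->
    vfield_smooth U X -> vfield_smooth U Y ->
    vfield_smooth U (fun p => nabla Y p (X p))
}.

(* nabla_X Y - nabla_Y X = [X, Y], both sides being seen as derivations *)
Definition torsion_free (nabla : (M -> 'rV[R]_n) -> M -> 'rV[R]_n -> 'rV[R]_n) :=
  forall (U : set M) X Y f p, open U -> U p ->
    vfield_smooth U X -> vfield_smooth U Y -> fun_smooth U f ->
    vderive f p (nabla Y p (X p) - nabla X p (Y p)) =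
      vderive (fun q => vderive f q (Y q)) p (X p) -
      vderive (fun q => vderive f q (X q)) p (Y p).

Definition parallel_form nabla (eta : M -> 'cV[R]_n) :=
  forall (U : set M) Y p u, open U -> U p -> vfield_smooth U Y ->
    vderive (fun q => form_app eta q (Y q)) p u = form_app eta p (nabla Y p u).

Definition parallel_bil nabla (g : M -> 'M[R]_n) :=
  forall (U : set M) Y Z p u, open U -> U p ->
    vfield_smooth U Y -> vfield_smooth U Z ->
    vderive (fun q => bil_app g q (Y q) (Z q)) p u =
      bil_app g p (nabla Y p u) (Z p) + bil_app g p (Y p) (nabla Z p u).

Definition levi_civita (g : M -> 'M[R]_n) nabla :=
  [/\ is_connection nabla, torsion_free nabla & parallel_bil nabla g].

(* D p stands for its row space, a subspace of T_pM *)
Definition smooth_distribution (D : M -> 'M[R]_n) :=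
  exists r, forall p, exists (U : set M) (E : 'I_r -> M -> 'rV[R]_n),
    [/\ open U, U p, forall i, vfield_smooth U (E i) &
        forall q, U q -> row_free (\matrix_i E i q) /\
                         (\matrix_i E i q :=: D q)%MS].

End Tensors.

Section Paracontact.
Context (m : nat) (M : manifold m.*2.+1).
Variables (phi : M -> 'M[R]_(m.*2.+1)) (xi : M -> 'rV[R]_(m.*2.+1))
  (eta : M -> 'cV[R]_(m.*2.+1)) (g : M -> 'M[R]_(m.*2.+1)).

Record lorentzian_almost_paracontact : Prop := {
  lap_phi_smooth : endo_smooth phi;
  lap_xi_smooth : vfield_smooth [set: M] xi;
  lap_eta_smooth : form_smooth eta;
  lap_lorentzian : lorentzian g;
  lap_phi2 : forall p u, u *m phi p *m phi p = u + form_app eta p u *: xi p;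
  lap_eta_xi : forall p, form_app eta p (xi p) = -1;
  lap_phi_xi : forall p, xi p *m phi p = 0;
  lap_eta_phi : forall p u, form_app eta p (u *m phi p) = 0;
  lap_rank : forall p, \rank (phi p) = m.*2;
  lap_compat : forall p u v, bil_app g p (u *m phi p) (v *m phi p) =
    bil_app g p u v + form_app eta p u * form_app eta p v
}.

(* the matrix of the bilinear form (u, v) |-> g (u, phi v) *)
Definition fundamental_form (p : M) : 'M[R]_(m.*2.+1) := g p *m (phi p)^T.

Definition lorentzian_paracosymplectic : Prop :=
  lorentzian_almost_paracontact /\
  exists nabla, [/\ levi_civita g nabla, parallel_form nabla eta &
                    parallel_bil nabla fundamental_form].

End Paracontact.

(* Subspaces of an inner product space ('rV_n, G) are row spaces *)
Section Angles.
Context n (G : 'M[R]_n).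

Definition gnorm (u : 'rV[R]_n) : R := Num.sqrt `|(u *m G *m u^T) 0 0|.

Definition orthcomp r (W : 'M[R]_(r, n)) : 'M[R]_n := kermx (G *m W^T).

Definition orthproj r (W : 'M[R]_(r, n)) (u : 'rV[R]_n) : 'rV[R]_n :=
  u *m proj_mx <<W>>%MS (orthcomp W).

(* The angle between u and the subspace W, when G is positive definite on the
   span of u and W. For u = phi X with X in a slant distribution D_theta this
   holds because u and D_theta are orthogonal to the timelike vector xi of a
   Lorentzian metric. *)
Definition angle r (W : 'M[R]_(r, n)) (u : 'rV[R]_n) : R :=
  acos (gnorm (orthproj W u) / gnorm u).

End Angles.

Section Submanifolds.
Context (m : nat) (M : manifold m.*2.+1).
Variables (phi : M -> 'M[R]_(m.*2.+1)) (xi : M -> 'rV[R]_(m.*2.+1))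
  (g : M -> 'M[R]_(m.*2.+1)).

Section Submanifold.
Context k (S : manifold k) (iota : S -> M).

Definition induced_metric (p : S) : 'M[R]_k :=
  dmap iota p *m g (iota p) *m (dmap iota p)^T.

Definition submanifold :=
  immersion iota /\ pseudo_riemannian induced_metric.

Definition invariant_submanifold :=
  submanifold /\
  forall p, (dmap iota p *m phi (iota p) <= dmap iota p)%MS.

(* W p is a subspace of T_(iota p)M *)
Definition pointwise_slant r (W : S -> 'M[R]_(r, m.*2.+1)) (theta : S -> R) :=
  forall p (u : 'rV[R]_(m.*2.+1)), (u <= W p)%MS -> ~~ (u <= xi (iota p))%MS ->
    angle (g (iota p)) (W p) (u *m phi (iota p)) = theta p.

Definition pointwise_proper_slant_submanifold :=
  submanifold /\
  exists2 theta, pointwise_slant (dmap iota) theta &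
                 forall p, cos (theta p) != 0.

Variables (DT Dtheta : S -> 'M[R]_k) (theta : S -> R).

(* the image of D p in T_(iota p)M *)
Definition push (D : S -> 'M[R]_k) (p : S) : 'M[R]_(k, m.*2.+1) :=
  D p *m dmap iota p.

Record pointwise_semi_slant : Prop := {
  pss_submanifold : submanifold;
  pss_DT_smooth : smooth_distribution DT;
  pss_Dtheta_smooth : smooth_distribution Dtheta;
  pss_sum : forall p,
    (push DT p + push Dtheta p + xi (iota p) :=: dmap iota p)%MS;
  pss_direct : forall p,
    mxdirect (push DT p + push Dtheta p + xi (iota p))%MS;
  pss_orth : forall p,
    [/\ push DT p *m g (iota p) *m (push Dtheta p)^T = 0,
        push DT p *m g (iota p) *m (xi (iota p))^T = 0 &
        push Dtheta p *m g (iota p) *m (xi (iota p))^T = 0];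
  pss_invariant : forall p, (push DT p *m phi (iota p) <= push DT p)%MS;
  pss_slant : pointwise_slant (push Dtheta) theta
}.

(* j : L -> S is an integral submanifold of the distribution E along iota *)
Definition integral_submanifold l (L : manifold l) (j : L -> S)
    r (E : S -> 'M[R]_(r, m.*2.+1)) :=
  [/\ injective j, immersion j &
      forall s, (dmap (iota \o j) s :=: E (j s))%MS].

End Submanifold.

Section WarpedProduct.
Context b k (B : manifold b) (F : manifold k).

Definition warped_metric (gB : B -> 'M[R]_b) (gF : F -> 'M[R]_k) (f : B -> R)
    (z : prod_manifold B F) : 'M[R]_(b + k) :=
  block_mx (gB z.1) 0 0 (f z.1 ^+ 2 *: gF z.2).

Definition fst_slice (q : F) (p : B) : prod_manifold B F := (p, q).
Definition snd_slice (p : B) (q : F) : prod_manifold B F := (p, q).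

(* B x_f F with B = M_theta and F = M_T, isometrically immersed by iota, where
   M_T is an integral submanifold of D_T + {xi} *)
Record semi_slant_warped_product (gB : B -> 'M[R]_b) (gF : F -> 'M[R]_k)
    (f : B -> R) (iota : prod_manifold B F -> M) DT Dtheta theta : Prop := {
  sswp_gB : pseudo_riemannian gB;
  sswp_gF : pseudo_riemannian gF;
  sswp_f_smooth : fun_smooth [set: B] f;
  sswp_f_gt0 : forall p, 0 < f p;
  sswp_isometric : forall z, induced_metric iota z = warped_metric gB gF f z;
  sswp_semi_slant : pointwise_semi_slant iota DT Dtheta theta;
  sswp_Mtheta_integral : forall q,
    integral_submanifold iota (fst_slice q) (push iota Dtheta);
  sswp_Mtheta_slant : forall q,
    pointwise_proper_slant_submanifold (iota \o fst_slice q);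
  sswp_MT_integral : forall p, integral_submanifold iota (snd_slice p)
    (fun z => push iota DT z + xi (iota z))%MS;
  sswp_MT_invariant : forall p, invariant_submanifold (iota \o snd_slice p)
}.

Definition tangent_to_snd (iota : prod_manifold B F -> M) := forall p q,
  (xi (iota (p, q)) <= dmap (iota \o snd_slice p) q)%MS.

End WarpedProduct.

End Submanifolds.

End Manifolds.

(* Main.v *)
Require Import Defs.
From mathcomp Require Import all_boot all_order all_algebra.
From mathcomp Require Import all_classical all_reals all_analysis.

(** Write an arbitrary tangent vector of the product as a pair (u, v) of a base
    and a fibre vector. As the metric is a warped product metric and xi is
    tangent to the fibres, xi = iota_*(0, w) along the submanifold, and
    eta = g(., xi) gives
      eta(iota_*(u, v)) = f(p)^2 gT(v, w)      at the point (p, q).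
    In particular iota^*eta vanishes on base vectors.

    A parallel 1-form is closed, since the connection is torsion free; hence so
    is iota^*eta. Differentiating in a base direction u and a fibre direction v,
      u(eta(iota_*(0, v))) = v(eta(iota_*(u, 0))) = 0,
    so that for a fixed point q and a fixed fibre vector v the number
    eta(iota_*(0, v)) at (p, q) does not depend on the point p of the connected
    base. Let w and w0 be the components of xi at (p, q) and (p0, q). Taking
    v = w and v = w0, and using eta(xi) = -1,
      f(p0)^2 gT(w, w0) = -1 = f(p)^2 gT(w0, w),
    whence f(p) = f(p0) by the symmetry of gT: the warping function is constant.

    The closedness of eta is expressed in each chart by means of the coordinate
    vector fields ([frame]), which commute for a torsion free connection
    ([frame_torsion_free], [parallel_form_closed]). It passes to iota^*eta by the
    symmetry of second derivatives ([schwarz], [pullback_closed]). Everything is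
    then evaluated on the slices of the product ([snd_part_const]). *)

Set Implicit Arguments.
Unset Strict Implicit.
Unset Printing Implicit Defensive.

Import Order.TTheory GRing.Theory Num.Theory.
Import numFieldNormedType.Exports.

Local Open Scope classical_set_scope.
Local Open Scope ring_scope.

(** * Directional derivatives and symmetry of second derivatives *)

Section DirectionalDerivative.
Context {R : realType}.

(** A directional derivative only depends on the values along the line, so that
    two functions on different spaces can be compared. This is how derivatives on
    a product are reduced to derivatives on its factors, without any chain rule.
    *)
Lemma eq_derive_along (V V' W : normedModType R) (f : V -> W) (g : V' -> W) x x' u u' :
  (\forall h \near (0 : R), f (h *: u + x) = g (h *: u' + x')) ->
  'D_u f x = 'D_u' g x'.
Proof.
move=> fg; rewrite /derive; congr (lim _).
have fg0 := nbhs_singleton fg; rewrite !scale0r !add0r in fg0.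
have E : \forall h \near 0^', h^-1 *: ((f \o shift x) (h *: u) - f x) =
    h^-1 *: ((g \o shift x') (h *: u') - g x').
  by apply: cvg_within; apply: filterS fg => h /= ->; rewrite fg0.
rewrite eqEsubset; split; apply/near_eq_cvg => //.
by apply: filterS E => h ->.
Qed.

Lemma eq_derivable_along (V V' W : normedModType R) (f : V -> W) (g : V' -> W) x x' u u' :
  (\forall h \near (0 : R), f (h *: u + x) = g (h *: u' + x')) ->
  derivable f x u -> derivable g x' u'.
Proof.
move=> fg /cvg_ex[/= l fl]; apply/cvg_ex; exists l => /=.
have fg0 := nbhs_singleton fg; rewrite !scale0r !add0r in fg0.
apply: cvg_trans fl; apply: near_eq_cvg.
by apply: cvg_within; apply: filterS fg => h /= ->; rewrite fg0.
Qed.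

Lemma derive_comp (U V W : normedModType R) (f : V -> W) (g : U -> V) x u :
  differentiable g x -> differentiable f (g x) ->
  'D_u (f \o g) x = 'D_('D_u g x) f (g x).
Proof.
move=> dg df; rewrite (deriveE _ (differentiable_comp dg df)) (diff_comp dg df).
by rewrite (deriveE _ df) (deriveE _ dg).
Qed.

Lemma mean_value_along (V : normedModType R) (f : V -> R^o) (x u : V) (h : R) :
  0 < h -> (forall s, 0 <= s <= h -> differentiable f (s *: u + x)) ->
  exists2 s, 0 <= s <= h & f (h *: u + x) - f x = h * 'D_u f (s *: u + x).
Proof.
move=> h0 df; pose F s := f (s *: u + x).
have dF s : 0 <= s <= h -> is_derive s 1 (F : R -> R) ('D_u f (s *: u + x)).
  move=> sh.
  have fF : \forall k \near (0 : R), f (k *: u + (s *: u + x)) = F (k *: 1 + s).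
    by apply: (@nearW _ (nbhs (0 : R))) => k; rewrite /F addrA -scalerDl [k%:A]mulr1.
  apply: DeriveDef.
    exact: (@eq_derivable_along V R R f F _ s u 1 fF (diff_derivable (df s sh))).
  by rewrite -(@eq_derive_along V R R f F _ s u 1 fF).
have [||s + E] := @MVT R F (fun s => 'D_u f (s *: u + x)) 0 h h0.
- by move=> s /[!in_itv]/= /andP[s0 sh]; apply: dF; rewrite !ltW.
- apply: derivable_within_continuous => s /[!in_itv]/= sh.
  exact: (@ex_derive _ _ _ _ _ _ _ (dF s sh)).
rewrite in_itv/= => /andP[s0 sh]; exists s; first by rewrite !ltW.
by move: E; rewrite /F subr0 scale0r add0r mulrC.
Qed.

(** Small parallelograms at x, with sides along u and v, stay in any given
    neighbourhood of x. *)
Lemma near_parallelogram (V : normedModType R) (x u v : V) (P : set V) :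
  (\forall y \near x, P y) ->
  \forall h \near (0 : R)^'+, forall s t, 0 <= s <= h -> 0 <= t <= h ->
    P (s *: u + (t *: v + x)).
Proof.
move=> /nbhs_normP[e /= e0 eP].
have d0 : 0 < e / (`|u| + `|v| + 1).
  by rewrite divr_gt0// ltr_wpDl// addr_ge0.
near=> h => s t /andP[s0 sh] /andP[t0 th]; apply: eP => /=.
rewrite addrA opprD addrCA subrr addr0 normrN.
rewrite (le_lt_trans (ler_normD _ _))// !normrZ !ger0_norm//.
apply: (@le_lt_trans _ _ (h * (`|u| + `|v| + 1))).
  rewrite !mulrDr mulr1 -[leLHS]addr0; apply: lerD; last exact: le_trans sh.
  by apply: lerD; rewrite ler_wpM2r.
have w0 : 0 < `|u| + `|v| + 1 by rewrite ltr_wpDl// addr_ge0.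
by rewrite -ltr_pdivlMr.
Unshelve. all: by end_near. Qed.

(** Two applications of the mean value theorem: to y |-> f (y + h v) - f y along
    u, and then to the derivative of f in the direction u, along v. *)
Lemma second_difference (V : normedModType R) (U : set V) (f : V -> R^o) x u v (h : R) :
  0 < h -> (forall y, U y -> differentiable f y) ->
  (forall y, U y -> differentiable ('D_u f) y) ->
  (forall s t, 0 <= s <= h -> 0 <= t <= h -> U (s *: u + (t *: v + x))) ->
  exists s t : R, [/\ 0 <= s <= h, 0 <= t <= h &
    f (h *: u + (h *: v + x)) - f (h *: u + x) - (f (h *: v + x) - f x) =
    h * (h * 'D_v ('D_u f) (s *: u + (t *: v + x)))].
Proof.
move=> h0 df Df hU; have [hh h0'] : 0 <= h <= h /\ 0 <= (0 : R) <= h.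
  by split; rewrite lexx ltW.
pose G y := f (y + h *: v) - f y.
have dsh w y : U (y + w) -> differentiable (f \o shift w) y.
  by move=> Uy; apply: differentiable_comp => //; exact: df.
have Us s t : 0 <= s <= h -> 0 <= t <= h -> U (s *: u + x + t *: v).
  by move=> s0 t0; rewrite -addrA [x + _]addrC; exact: hU.
have Us0 s : 0 <= s <= h -> U (s *: u + x).
  by move=> s0; have := hU _ _ s0 h0'; rewrite scale0r add0r.
have [|s s0 E] := @mean_value_along _ G x u h h0.
  by move=> s s0; apply: differentiableB; [apply: dsh; exact: Us|apply/df/Us0].
have [|t t0 E'] := @mean_value_along _ ('D_u f : V -> R^o) (s *: u + x) v h h0.
  move=> t t0; apply: Df.
  by rewrite addrCA; exact: hU.
exists s, t; split => //.
have -> : s *: u + (t *: v + x) = t *: v + (s *: u + x) by rewrite addrCA.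
rewrite -E'.
have -> : 'D_u f (h *: v + (s *: u + x)) - 'D_u f (s *: u + x) = 'D_u G (s *: u + x).
  have -> : G = (f \o shift (h *: v)) - f by [].
  rewrite deriveB.
  - congr (_ - _); apply: eq_derive_along; apply: (@nearW _ (nbhs (0 : R))) => k /=.
    by congr f; rewrite -addrA; congr (_ + _); rewrite addrC.
  - by apply: diff_derivable; apply: dsh; exact: Us.
  - by apply: diff_derivable; apply/df/Us0.
rewrite -E /G; congr (f _ - _ - (f _ - _)).
  by rewrite -addrA [x + _]addrC.
by rewrite addrC.
Qed.

Lemma second_difference_sym (h a b c d p q : R) : h != 0 ->
  a - b - (c - d) = h * (h * p) -> a - c - (b - d) = h * (h * q) -> q = p.
Proof.
move=> h0 E1 E2; apply: (mulfI h0); apply: (mulfI h0); rewrite -E1 -E2.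
by rewrite !opprB addrACA [RHS]addrACA; congr (_ + _); rewrite addrC.
Qed.

Lemma dist_lt_halves (p q c e : R) : `|p - c| < e / 2 -> `|q - c| < e / 2 ->
  `|p - q| < e.
Proof.
move=> pc qc; rewrite (splitr e) -(subrKA c) (le_lt_trans (ler_normD _ _))//.
by rewrite ltrD// distrC.
Qed.

(** The second difference of f on the parallelogram of sides h u and h v is
    symmetric in u and v, and equals h^2 times either mixed derivative, each taken
    at a suitable point of the parallelogram. Let h tend to 0. *)
Lemma schwarz (V : normedModType R) (U : set V) (f : V -> R^o) x u v :
  open U -> U x -> (forall y, U y -> differentiable f y) ->
  (forall w y, U y -> differentiable ('D_w f) y) ->
  {for x, continuous ('D_u ('D_v f) : V -> R^o)} ->
  {for x, continuous ('D_v ('D_u f) : V -> R^o)} ->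
  'D_u ('D_v f) x = 'D_v ('D_u f) x.
Proof.
move=> oU Ux df Df cuv cvu.
apply/eqP; rewrite -subr_eq0 -normr_le0; apply/ler_addgt0Pr => e e0.
rewrite add0r.
have e20 : 0 < e / 2 by rewrite divr_gt0.
pose Q y := U y /\ (`|'D_u ('D_v f) x - 'D_u ('D_v f) y| < e / 2 /\
    `|'D_v ('D_u f) x - 'D_v ('D_u f) y| < e / 2).
have N : \forall y \near x, Q y.
  have N1 : nbhs x U by exact: open_nbhs_nbhs.
  have /cvgrPdist_lt/(_ _ e20) N2 := cuv.
  have /cvgrPdist_lt/(_ _ e20) N3 := cvu.
  move: N1 N2 N3; apply: filterS3 => y a b c.
  by split; [exact: a|split; [exact: b|exact: c]].
have [h [h0 [H1 H2]]] : exists h : R, 0 < h /\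
    (forall s t, 0 <= s <= h -> 0 <= t <= h -> Q (s *: u + (t *: v + x))) /\
    (forall s t, 0 <= s <= h -> 0 <= t <= h -> Q (s *: v + (t *: u + x))).
  apply: (@filter_ex _ (0 : R)^'+).
  apply: filterS3 (nbhs_right_gt 0) (near_parallelogram u v N) (near_parallelogram v u N) => h.
  by move=> h0 H1 H2; split; [exact: h0|split; [exact: H1|exact: H2]].
have [|s [t [s0 t0 E1]]] := @second_difference V U f x u v h h0 df (Df u).
  by move=> s t s0 t0; have [] := H1 s t s0 t0.
have [|s' [t' [s0' t0' E2]]] := @second_difference V U f x v u h h0 df (Df v).
  by move=> s' t' s0' t0'; have [] := H2 s' t' s0' t0'.
have [_ [_ C1]] := H1 _ _ s0 t0; have [_ [C2 _]] := H2 _ _ s0' t0'.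
rewrite [h *: v + _]addrCA in E2.
have E := second_difference_sym (lt0r_neq0 h0) E1 E2.
rewrite -E in C1.
exact: ltW (dist_lt_halves C2 C1).
Qed.

End DirectionalDerivative.

(** * Calculus of C^k functions *)

Section CkCalculus.
Context {R : realType}.

Lemma CkW n (V : normedModType R) k (U : set 'rV[R]_n) (f : 'rV[R]_n -> V) :
  Ck k.+1 U f -> Ck k U f.
Proof.
elim: k f => [|k IH] f [df Df].
  by move=> x Ux; exact/differentiable_continuous/df.
by split=> // v; exact: IH.
Qed.

Lemma Ck_cst n (V : normedModType R) k (U : set 'rV[R]_n) (a : V) :
  Ck k U (cst a : 'rV[R]_n -> V).
Proof.
elim: k a => [|k IH] a /=; first by move=> x _; exact: cst_continuous.
split=> [x _|v]; first exact: differentiable_cst.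
rewrite (_ : (fun x => _) = cst 0); first exact: IH.
by apply/funext => x; exact: derive_cst.
Qed.

Lemma Ck_sum n (V : normedModType R) k (U : set 'rV[R]_n) m
    (f : 'I_m -> 'rV[R]_n -> V) :
  open U -> (forall i, Ck k U (f i)) -> Ck k U (fun x => \sum_i f i x).
Proof.
move=> oU cf; rewrite (_ : (fun x => _) = \sum_i f i); last first.
  by apply/funext => x; rewrite fct_sumE.
elim/big_ind: _ => [|g h cg ch|i _]; [exact: Ck_cst|exact: CkD|exact: cf].
Qed.

Lemma CkM n k (U : set 'rV[R]_n) (f g : 'rV[R]_n -> R^o) :
  open U -> Ck k U f -> Ck k U g -> Ck k U (fun x => f x * g x : R^o).
Proof.
move=> oU; elim: k f g => [|k IH] f g.
  by move=> cf cg x Ux; apply: continuousM; [exact: cf|exact: cg].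
move=> cf cg; have [df Df] := cf; have [dg Dg] := cg; split=> [x Ux|v].
  by apply: differentiableM; [exact: df|exact: dg].
have H := CkD oU (IH _ _ (CkW cf) (Dg v)) (IH _ _ (CkW cg) (Df v)).
apply: (Ck_ext oU _ H) => x Ux /=.
by rewrite -[RHS]/('D_v (f * g) x) deriveM//; apply: diff_derivable; auto.
Qed.

Lemma CkZl n k (V : normedModType R) (U : set 'rV[R]_n) (f : 'rV[R]_n -> R^o)
    (a : V) :
  open U -> Ck k U f -> Ck k U (fun x => f x *: a).
Proof.
move=> oU; elim: k f => [|k IH] f.
  move=> cf x Ux; apply: (@continuous_comp _ _ _ f ( *:%R^~ a)); first exact: cf.
  exact: scalel_continuous.
move=> [df Df]; split=> [x Ux|v]; first by apply: differentiableZl; exact: df.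
apply: (Ck_ext oU _ (IH _ (Df v))) => x Ux /=.
rewrite [RHS]deriveE; last by apply: differentiableZl; exact: df.
by rewrite (diffZl a (df _ Ux)) -deriveE//; exact: df.
Qed.

Lemma derive_coord (V : normedModType R) m n (f : V -> 'M[R]_(m, n)) x u i j :
  differentiable f x -> 'D_u (fun y => f y i j : R^o) x = 'D_u f x i j.
Proof.
by move=> df; rewrite (derive_mx (diff_derivable df)) mxE.
Qed.

Lemma differentiable_coord_comp (V : normedModType R) m n
    (f : V -> 'M[R]_(m, n)) x i j :
  differentiable f x -> differentiable (fun y => f y i j : R^o) x.
Proof.
move=> df; apply: (@differentiable_comp _ _ _ _ f (fun A => A i j : R^o)) => //.
exact: differentiable_coord.
Qed.

Lemma Ck_coord n m k (U : set 'rV[R]_n) (f : 'rV[R]_n -> 'rV[R]_m) j :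
  open U -> Ck k U f -> Ck k U (fun x => f x 0 j : R^o).
Proof.
move=> oU; elim: k f => [|k IH] f.
  move=> cf x Ux; apply: (@continuous_comp _ _ _ f (fun A => A 0 j : R^o)).
    exact: cf.
  exact: coord_continuous.
move=> [df Df]; split=> [x Ux|v].
  by apply: differentiable_coord_comp; exact: df.
apply: (Ck_ext oU _ (IH _ (Df v))) => x Ux /=.
by rewrite derive_coord//; exact: df.
Qed.

Lemma Ck_row n m k (U : set 'rV[R]_n) (f : 'rV[R]_n -> 'rV[R]_m) :
  open U -> (forall j, Ck k U (fun x => f x 0 j : R^o)) -> Ck k U f.
Proof.
move=> oU cf; rewrite (_ : f = fun x => \sum_j f x 0 j *: delta_mx 0 j).
  by apply: Ck_sum => // j; exact: CkZl.
by apply/funext => y; rewrite -row_sum_delta.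
Qed.

Lemma derive_basis (W : normedModType R) n (f : 'rV[R]_n -> W) x (u : 'rV[R]_n) :
  differentiable f x -> 'D_u f x = \sum_j u 0 j *: 'D_(delta_mx 0 j) f x.
Proof.
move=> df; rewrite deriveE// {1}(row_sum_delta u) linear_sum.
by apply: eq_bigr => j _; rewrite linearZ/= deriveE.
Qed.

(** By the chain rule, the derivatives of f \o g are sums of products of
    derivatives of components of g and of partial derivatives of f composed with
    g, which are C^k by induction. *)
Lemma Ck_comp_scalar n m k (U : set 'rV[R]_n) (W : set 'rV[R]_m)
    (f : 'rV[R]_m -> R^o) (g : 'rV[R]_n -> 'rV[R]_m) :
  open U -> (forall x, U x -> W (g x)) -> Ck k W f -> Ck k U g ->
  Ck k U (f \o g).
Proof.
move=> oU gW; elim: k f => [|k IH] f.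
  by move=> cf cg x Ux; apply: continuous_comp; [exact: cg|apply: cf; exact: gW].
move=> [df Df] cg; have [dg Dg] := cg; split=> [x Ux|v].
  by apply: differentiable_comp; [exact: dg|apply: df; exact: gW].
have H j := CkM oU (Ck_coord j oU (Dg v)) (IH _ (Df (delta_mx 0 j)) (CkW cg)).
apply: (Ck_ext oU _ (Ck_sum oU H)) => x Ux /=.
rewrite (derive_comp v (dg _ Ux) (df _ (gW _ Ux))).
by rewrite (derive_basis _ (df _ (gW _ Ux))).
Qed.

Lemma Ck_comp n m p k (U : set 'rV[R]_n) (W : set 'rV[R]_m)
    (f : 'rV[R]_m -> 'rV[R]_p) (g : 'rV[R]_n -> 'rV[R]_m) :
  open U -> open W -> (forall x, U x -> W (g x)) -> Ck k W f -> Ck k U g ->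
  Ck k U (f \o g).
Proof.
move=> oU oW gW cf cg; apply: Ck_row => // j.
exact: (Ck_comp_scalar oU gW (Ck_coord j oW cf) cg).
Qed.

End CkCalculus.

(** * Changes of charts and coordinate frames *)

Section Jacobians.
Context {R : realType}.

Lemma eq_jacobian n m (f : 'rV[R]_n -> 'rV[R]_m) (A : 'M[R]_(n, m)) x :
  differentiable f x -> (forall u, 'D_u f x = u *m A) -> 'J f x = A.
Proof.
move=> df fA; apply/row_matrixP => i; rewrite [LHS]rowE [RHS]rowE -fA.
by rewrite (deriveEjacobian _ df).
Qed.

Lemma near_eq_jacobian n m (f g : 'rV[R]_n -> 'rV[R]_m) x :
  (\forall y \near x, f y = g y) -> differentiable f x -> 'J f x = 'J g x.
Proof.
move=> fg df; have dg := near_eq_differentiable fg df.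
apply: (eq_jacobian df) => u; rewrite -(deriveEjacobian u dg).
exact: near_eq_derive.
Qed.

Lemma jacobian_comp n m p (f : 'rV[R]_m -> 'rV[R]_p) (g : 'rV[R]_n -> 'rV[R]_m) x :
  differentiable g x -> differentiable f (g x) ->
  'J (f \o g) x = 'J g x *m 'J f (g x).
Proof.
move=> dg df; apply: (eq_jacobian (differentiable_comp dg df)) => u.
rewrite mulmxA -(deriveEjacobian u dg) -(deriveEjacobian _ df).
exact: derive_comp.
Qed.

Lemma jacobian_id n (x : 'rV[R]_n) : 'J id x = 1%:M.
Proof.
by apply: eq_jacobian => [//|u]; rewrite mulmx1; exact: derive_id.
Qed.

End Jacobians.

Section ChartChange.
Context {R : realType}.

Lemma chart_img_openI n (T : topologicalType) (c : @chart R n T) (U : set T) :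
  open U -> open (c @` (chart_dom c `&` U)).
Proof.
move=> oU; rewrite (_ : _ @` _ = c @` chart_dom c `&` (chart_inv c @^-1` U)).
  rewrite openE => x [[p dp <-] Up]; apply: (@filterI _ _ (@nbhs_filter _ (c p))).
    by apply: open_nbhs_nbhs; split; [exact: chart_img_open|exists p].
  by apply: (chart_inv_cont dp); exact: open_nbhs_nbhs.
apply/seteqP; split=> [_ [p [dp Up] <-]|x [[p dp <-]]].
  by split; [exists p|rewrite /= chart_funK].
by rewrite /= chart_funK// => Up; exists p.
Qed.

(** Transports a property that holds near p to the points near c p, which are
    exhibited as images of points of the domain of c. *)
Lemma near_chart n (T : topologicalType) (c : @chart R n T) p (P : set T) :
  chart_dom c p -> nbhs p P ->
  nbhs (c p) [set x | exists2 q, chart_dom c q /\ P q & x = c q].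
Proof.
move=> dp; rewrite nbhsE => -[U [oU Up] UP].
have oW := chart_img_openI (c := c) oU.
have : nbhs (c p) (c @` (chart_dom c `&` U)).
  by apply: open_nbhs_nbhs; split => //; exists p.
apply: (@filterS _ _ (@nbhs_filter _ (c p))) => x [q [dq Uq] <-].
by exists q => //; split => //; exact: UP.
Qed.

Lemma smooth_differentiable n (V : normedModType R) (U : set 'rV[R]_n) (f : 'rV[R]_n -> V) x :
  smooth U f -> U x -> differentiable f x.
Proof. by move=> sf; exact: (sf 1%N).1. Qed.

Context n (M : @manifold R n).
Implicit Types (c : @chart R n M) (p q : M).

(** The matrix of the change of coordinates of T_pM from the chart c to c'. *)
Definition transition (c c' : @chart R n M) p : 'M[R]_n := 'J (c' \o chart_inv c) (c p).

Lemma transition_diff c c' p : atlas c -> atlas c' -> chart_dom c p ->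
  chart_dom c' p -> differentiable (c' \o chart_inv c) (c p).
Proof.
move=> Ac Ac' dp dp'; apply: (smooth_differentiable (atlas_compat Ac Ac')).
by exists p.
Qed.

Lemma near_transition (S : Type) (G : M -> S) c c' p : chart_dom c p -> chart_dom c' p ->
  \forall x \near c p, ((G \o chart_inv c') \o (c' \o chart_inv c)) x =
    (G \o chart_inv c) x.
Proof.
move=> dp dp'.
have := near_chart dp (open_nbhs_nbhs (conj (chart_dom_open c') dp')).
apply: (@filterS _ _ (@nbhs_filter _ (c p))) => x [q [dq dq'] ->] /=.
by rewrite !chart_funK.
Qed.

Lemma chart_change_diff (V : normedModType R) (G : M -> V) c c' p :
  atlas c -> atlas c' -> chart_dom c p -> chart_dom c' p ->
  differentiable (G \o chart_inv c') (c' p) ->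
  differentiable (G \o chart_inv c) (c p).
Proof.
move=> Ac Ac' dp dp' dG.
apply: (near_eq_differentiable (near_transition G dp dp')).
apply: differentiable_comp; first exact: transition_diff.
by rewrite /= chart_funK.
Qed.

Lemma chart_change_derive (V : normedModType R) (G : M -> V) c c' p u :
  atlas c -> atlas c' -> chart_dom c p -> chart_dom c' p ->
  differentiable (G \o chart_inv c') (c' p) ->
  'D_u (G \o chart_inv c) (c p) = 'D_(u *m transition c c' p) (G \o chart_inv c') (c' p).
Proof.
move=> Ac Ac' dp dp' dG; have dt := transition_diff Ac Ac' dp dp'.
have Ep : (c' \o chart_inv c) (c p) = c' p by rewrite /= chart_funK.
rewrite -Ep in dG *.
rewrite -(near_eq_derive _ (near_transition G dp dp')) (derive_comp _ dt dG).
by rewrite (deriveEjacobian _ dt).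
Qed.

Lemma transition_comp c c' c'' p : atlas c -> atlas c' -> atlas c'' ->
  chart_dom c p -> chart_dom c' p -> chart_dom c'' p ->
  transition c c' p *m transition c' c'' p = transition c c'' p.
Proof.
move=> A A' A'' d d' d''.
have Ep : (c' \o chart_inv c) (c p) = c' p by rewrite /= chart_funK.
have dt := transition_diff A A' d d'.
have dt' := transition_diff A' A'' d' d''.
rewrite -Ep in dt'.
have N := near_transition (c'' : M -> 'rV[R]_n) d d'.
rewrite /transition -(near_eq_jacobian N (differentiable_comp dt dt')).
by rewrite (jacobian_comp dt dt') Ep.
Qed.

Lemma transition_id c p : atlas c -> chart_dom c p -> transition c c p = 1%:M.
Proof.
move=> A d; rewrite /transition -(jacobian_id (c p)).
apply: near_eq_jacobian; last exact: transition_diff.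
have := near_chart d (@filterT _ _ (@nbhs_filter _ p)).
apply: (@filterS _ _ (@nbhs_filter _ (c p))) => x [q [dq _] ->] /=.
by rewrite chart_funK.
Qed.

(** The vector field with constant components v in the chart c, read in the
    chart chosen at each point, as vector fields are. *)
Definition frame c (v : 'rV[R]_n) (q : M) : 'rV[R]_n :=
  v *m transition c (chart_at q) q.

(** In another chart c' the field reads as the derivative of the transition map
    c' \o c^-1 in the direction v, composed with c \o c'^-1. *)
Lemma frame_smooth c v : atlas c -> vfield_smooth (chart_dom c) (frame c v).
Proof.
move=> Ac c' Ac' k.
have oW := chart_img_openI (c := c) (chart_dom_open c').
have oW' := chart_img_openI (c := c') (chart_dom_open c).
have cw x : (c' @` (chart_dom c' `&` chart_dom c)) x ->
    (c @` (chart_dom c `&` chart_dom c')) ((c \o chart_inv c') x).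
  by move=> [q [dq' dq] <-]; rewrite /= chart_funK//; exists q.
have H := Ck_comp oW' oW cw ((atlas_compat Ac Ac' k.+1).2 v) (atlas_compat Ac' Ac k).
apply: (Ck_ext oW' _ H) => _ [q [dq' dq] <-] /=.
rewrite !chart_funK//.
rewrite (deriveEjacobian _ (transition_diff Ac Ac' dq dq')).
rewrite -/(transition c c' q) /frame -[tangent_coord _ _]/(transition (chart_at q) c' q).
rewrite -mulmxA transition_comp//; first exact: atlas_chart_at.
exact: chart_at_dom.
Qed.

Lemma vderive_frame (h : M -> R) c v p : atlas c -> chart_dom c p ->
  differentiable (h \o chart_inv c : _ -> R^o) (c p) ->
  vderive h p (frame c v p) = 'D_v (h \o chart_inv c : _ -> R^o) (c p).
Proof.
move=> Ac dp dh; have Ap := atlas_chart_at p; have dpp := chart_at_dom p.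
rewrite (@chart_change_derive R^o h c (chart_at p))//.
exact: (@chart_change_diff R^o h _ c).
Qed.

Definition coordinate c (j : 'I_n) (q : M) : R := c q 0 j.

Lemma coordinate_smooth c j : atlas c -> fun_smooth (chart_dom c) (coordinate c j).
Proof.
move=> Ac c' Ac' k.
have oW' := chart_img_openI (c := c') (chart_dom_open c).
exact: (Ck_coord j oW' (atlas_compat Ac' Ac k)).
Qed.

Lemma vderive_coordinate c j p u : atlas c -> chart_dom c p ->
  vderive (coordinate c j) p u = (u *m transition (chart_at p) c p) 0 j.
Proof.
move=> Ac dp; have Ap := atlas_chart_at p; have dpp := chart_at_dom p.
have dt := transition_diff Ap Ac dpp dp.
by rewrite /vderive -(deriveEjacobian _ dt) -derive_coord.
Qed.

Lemma near_eq_vderive (h h' : M -> R) p u :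
  nbhs p [set q | h q = h' q] -> vderive h p u = vderive h' p u.
Proof.
move=> hh'; apply: near_eq_derive; have dpp := chart_at_dom p.
have := near_chart dpp hh'.
apply: (@filterS _ _ (@nbhs_filter _ _)) => x [q [dq hq] ->] /=.
by rewrite chart_funK.
Qed.

Lemma vderive_coordinate_frame c j v p : atlas c -> chart_dom c p ->
  vderive (coordinate c j) p (frame c v p) = v 0 j.
Proof.
move=> Ac dp; rewrite vderive_coordinate// -mulmxA transition_comp//.
- by rewrite transition_id// mulmx1.
- exact: atlas_chart_at.
- exact: chart_at_dom.
Qed.

(** Coordinate fields commute: the derivative of a coordinate function of c along
    a coordinate field is constant, so the torsion identity, tested on the
    coordinate functions, kills every component of the difference. *)
Lemma frame_torsion_free nabla c u v p : torsion_free nabla ->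
  atlas c -> chart_dom c p ->
  nabla (frame c v) p (frame c u p) = nabla (frame c u) p (frame c v p).
Proof.
move=> tf Ac dp; apply/eqP; rewrite -subr_eq0; apply/eqP.
set w := _ - _.
have dc w1 w2 j : vderive (fun q => vderive (coordinate c j) q (frame c w1 q)) p w2 = 0.
  rewrite (@near_eq_vderive _ (cst (w1 0 j))) /vderive; first exact: derive_cst.
  have := open_nbhs_nbhs (conj (chart_dom_open c) dp).
  apply: (@filterS _ _ (@nbhs_filter _ _)) => q dq /=.
  exact: vderive_coordinate_frame.
have w0 : w *m transition (chart_at p) c p = 0.
  apply/rowP => j; rewrite [RHS]mxE -(vderive_coordinate _ _ Ac dp).
  have := tf _ _ _ _ _ (chart_dom_open c) dp (frame_smooth u Ac) (frame_smooth v Ac)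
    (coordinate_smooth j Ac).
  by rewrite !dc subrr.
have Ap := atlas_chart_at p; have dpp := chart_at_dom p.
rewrite -[w]mulmx1 -(transition_id Ap dpp) -(transition_comp Ap Ac Ap)//.
by rewrite mulmxA w0 mul0mx.
Qed.

(** The components of eta in the chart c, as a function on the image of c. *)
Definition coord_form c (eta : M -> 'cV[R]_n) (x : 'rV[R]_n) : 'cV[R]_n :=
  transition c (chart_at (chart_inv c x)) (chart_inv c x) *m eta (chart_inv c x).

Lemma coord_formE c eta (v x : 'rV[R]_n) : (v *m coord_form c eta x) 0 0 =
  ((fun q => form_app eta q (frame c v q)) \o chart_inv c) x.
Proof. by rewrite /coord_form mulmxA. Qed.

Lemma coord_form_diff c eta (v : 'rV[R]_n) p : form_smooth eta -> atlas c -> chart_dom c p ->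
  differentiable (fun x => (v *m coord_form c eta x) 0 0 : R^o) (c p).
Proof.
move=> se Ac dp; under eq_fun do rewrite coord_formE.
apply: (smooth_differentiable (se _ _ (chart_dom_open c) (frame_smooth v Ac) c Ac)).
by exists p.
Qed.

(** The components of d eta in every chart of the atlas vanish. *)
Definition closed_form (eta : M -> 'cV[R]_n) := forall c p (u v : 'rV[R]_n),
  atlas c -> chart_dom c p ->
  'D_u (fun x => (v *m coord_form c eta x) 0 0 : R^o) (c p) =
  'D_v (fun x => (u *m coord_form c eta x) 0 0 : R^o) (c p).

(** For parallel eta, u(eta(V)) = eta(nabla_u V), and for commuting fields U and
    V and a torsion free connection nabla_U V = nabla_V U. *)
Lemma parallel_form_closed nabla (eta : M -> 'cV[R]_n) :
  torsion_free nabla -> parallel_form nabla eta -> form_smooth eta ->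
  closed_form eta.
Proof.
move=> tf pf se c p u v Ac dp.
have E w : (fun x => (w *m coord_form c eta x) 0 0 : R^o) =
   (fun q => form_app eta q (frame c w q)) \o chart_inv c.
  by apply/funext => x; rewrite coord_formE.
have D w := coord_form_diff w se Ac dp.
rewrite !E in D *.
rewrite -!vderive_frame//; try by rewrite -E; apply: coord_form_diff.
rewrite !(pf _ _ _ _ (chart_dom_open c) dp (frame_smooth _ Ac)).
by rewrite (frame_torsion_free u v tf Ac dp).
Qed.

End ChartChange.

(** * Closed forms pull back to closed forms *)

Section Pairing.
Context {R : realType}.

Lemma schwarz_row d n (W : set 'rV[R]_d) (Y : 'rV[R]_d -> 'rV[R]_n) x u v :
  open W -> W x -> Ck 2 W Y -> 'D_u ('D_v Y) x = 'D_v ('D_u Y) x.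
Proof.
move=> oW Wx cY; have [dY DY] := cY.
have comp a b j : 'D_a ('D_b Y) x 0 j =
    'D_a ('D_b (fun y => Y y 0 j : R^o) : _ -> R^o) x.
  rewrite -(derive_coord a _ _ ((DY b).1 _ Wx)).
  apply: near_eq_derive.
  have := open_nbhs_nbhs (conj oW Wx).
  apply: (@filterS _ _ (@nbhs_filter _ x)) => y Wy.
  by rewrite (derive_coord b _ _ (dY _ Wy)).
apply/rowP => j.
apply: (etrans (comp u v j)); apply: (etrans _ (esym (comp v u j))).
have [df Df] := Ck_coord j oW cY.
apply: (schwarz oW Wx df).
- by move=> w y Wy; exact: (Df w).1.
- exact: (Df v).2.
- exact: (Df u).2.
Qed.

Context d n (E : 'rV[R]_n -> 'cV[R]_n) (Y Z : 'rV[R]_d -> 'rV[R]_n).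
Variable x : 'rV[R]_d.
Hypothesis dE : forall w : 'rV[R]_n,
  differentiable (fun y => (w *m E y) 0 0 : R^o) (Y x).
Hypotheses (dY : differentiable Y x) (dZ : differentiable Z x).

Let Ej j (y : 'rV[R]_n) : R^o := (delta_mx (0 : 'I_1) j *m E y) 0 0.

Let pairE (w : 'rV[R]_n) y : (w *m E y) 0 0 = \sum_j w 0 j * Ej j y.
Proof.
rewrite {1}(row_sum_delta w) mulmx_suml summxE.
by apply: eq_bigr => j _; rewrite -scalemxAl mxE.
Qed.

Let pairingE : (fun y => (Z y *m E (Y y)) 0 0 : R^o) =
  \sum_j ((fun y => Z y 0 j : R^o) * (Ej j \o Y)).
Proof. by apply/funext => y; rewrite fct_sumE pairE. Qed.

Let dZj j : differentiable (fun y => Z y 0 j : R^o) x.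
Proof. exact: differentiable_coord_comp. Qed.

Let dEj j : differentiable (Ej j \o Y) x.
Proof. by apply: differentiable_comp; [exact: dY|exact: dE]. Qed.

Lemma differentiable_pairing :
  differentiable (fun y => (Z y *m E (Y y)) 0 0 : R^o) x.
Proof.
rewrite pairingE; apply: differentiable_sum => j.
by apply: differentiableM; [exact: dZj|exact: dEj].
Qed.

(** Product rule for the pairing of a vector field Z with a form E along Y. *)
Lemma derive_pairing u :
  'D_u (fun y => (Z y *m E (Y y)) 0 0 : R^o) x =
  ('D_u Z x *m E (Y x)) 0 0 +
  'D_('D_u Y x) (fun y => (Z x *m E y) 0 0 : R^o) (Y x).
Proof.
have -> : (fun y => (Z x *m E y) 0 0 : R^o) = \sum_j (Z x 0 j *: Ej j).
  by apply/funext => y; rewrite fct_sumE pairE.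
rewrite pairingE derive_sum; last first.
  by move=> j; apply: diff_derivable; apply: differentiableM;
    [exact: dZj|exact: dEj].
rewrite derive_sum; last first.
  by move=> j; apply: derivableZ; apply: diff_derivable; exact: dE.
rewrite pairE -big_split; apply: eq_bigr => j _.
rewrite (deriveM (diff_derivable (dZj j)) (diff_derivable (dEj j))).
rewrite (deriveZ _ (diff_derivable (dE _))) (derive_comp u dY (dE _)).
by rewrite (derive_coord _ _ _ dZ) addrC /= mulrC.
Qed.

End Pairing.

Section PullbackClosed.
Context {R : realType}.

(** The function differentiated on the left is the component along v of the
    pullback of the form E by Y. In the product rule, the terms with second
    derivatives of Y agree by their symmetry, the terms with derivatives of E by
    the closedness of E. *)
Lemma pullback_closed d n (W : set 'rV[R]_d) (Y : 'rV[R]_d -> 'rV[R]_n)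
    (E : 'rV[R]_n -> 'cV[R]_n) x u v :
  open W -> W x -> Ck 2 W Y ->
  (forall w : 'rV[R]_n, differentiable (fun y => (w *m E y) 0 0 : R^o) (Y x)) ->
  (forall a b : 'rV[R]_n, 'D_a (fun y => (b *m E y) 0 0 : R^o) (Y x) =
     'D_b (fun y => (a *m E y) 0 0 : R^o) (Y x)) ->
  'D_u (fun y => ('D_v Y y *m E (Y y)) 0 0 : R^o) x =
  'D_v (fun y => ('D_u Y y *m E (Y y)) 0 0 : R^o) x.
Proof.
move=> oW Wx cY dE clE; have [dY DY] := cY.
have P a b := derive_pairing dE (dY _ Wx) ((DY b).1 _ Wx) a.
apply: (etrans (P u v)); apply: (etrans _ (esym (P v u))).
have S := congr1 (fun A : 'rV[R]_n => (A *m E (Y x)) 0 0) (schwarz_row u v oW Wx cY).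
exact: (f_equal2 +%R S (clE _ _)).
Qed.

End PullbackClosed.

(** * Functions without derivative *)

Section Constancy.
Context {R : realType} n (B : @manifold R n) (h : B -> R).
Hypothesis dh : forall p,
  differentiable (h \o chart_inv (chart_at p) : _ -> R^o) (chart_at p p).
Hypothesis h0 : forall p u, vderive h p u = 0.

(** The mean value theorem along the segments of a ball in a chart at p. *)
Lemma locally_constant p : nbhs p [set q | h q = h p].
Proof.
pose c := chart_at p; have Ac : atlas c := atlas_chart_at p.
have dp : chart_dom c p := chart_at_dom p.
have dH q : chart_dom c q -> differentiable (h \o chart_inv c : _ -> R^o) (c q).
  move=> dq; apply: (@chart_change_diff _ _ _ R^o h c (chart_at q)) => //.
  - exact: atlas_chart_at.
  - exact: chart_at_dom.
have H0 q u : chart_dom c q -> 'D_u (h \o chart_inv c : _ -> R^o) (c q) = 0.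
  move=> dq; rewrite (@chart_change_derive _ _ _ R^o h c (chart_at q))//.
  - exact: h0.
  - exact: atlas_chart_at.
  - exact: chart_at_dom.
have : nbhs (c p) (c @` chart_dom c).
  by apply: open_nbhs_nbhs; split; [exact: chart_img_open|exists p].
move=> /nbhs_normP[e /= e0 eB].
have N : nbhs p [set q | `|c p - c q| < e].
  have /cvgrPdist_lt/(_ _ e0) := chart_fun_cont dp.
  exact.
have := open_nbhs_nbhs (conj (chart_dom_open c) dp).
apply: filterS2 N => q qe dq.
have B1 s : 0 <= s <= 1 -> exists2 r, chart_dom c r & c r = s *: (c q - c p) + c p.
  move=> /andP[s0 s1]; suff [r dr <-] : (c @` chart_dom c) (s *: (c q - c p) + c p).
    by exists r.
  apply: eB => /=; rewrite opprD addrCA subrr addr0 normrN normrZ ger0_norm//.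
  rewrite (le_lt_trans _ qe)// distrC.
  by rewrite -[leRHS]mul1r ler_wpM2r.
have [|s /B1[r dr <-]] := @mean_value_along _ _ (h \o chart_inv c) (c p) (c q - c p) 1 ltr01.
  by move=> s /B1[r dr <-]; exact: dH.
rewrite H0// scale1r subrK /= !chart_funK// mulr0 => /eqP.
by rewrite subr_eq0 => /eqP.
Qed.

Lemma connected_constant p q : connected [set: B] -> h q = h p.
Proof.
move=> cB; have lc := locally_constant.
suff E : [set q | h q = h p] = [set: B] by have : [set: B] q by []; rewrite -E.
apply: cB.
- by exists p.
- exists [set q | h q = h p]; rewrite ?setTI// openE => r /= hr.
  by apply: filterS (lc r) => r' /= ->.
- exists [set q | h q = h p]; rewrite ?setTI// -openC openE => r /= hr.
  by apply: filterS (lc r) => r' /= E; rewrite E.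
Qed.

End Constancy.

(** * Immersed products and their slices *)

Section Dmap.
Context {R : realType} (k n : nat) (S : @manifold R k) (M : @manifold R n) (iota : S -> M).
Hypothesis si : smooth_map iota.

Lemma smooth_map_diff c c' z : atlas c -> atlas c' -> chart_dom c z ->
  chart_dom c' (iota z) -> differentiable (c' \o iota \o chart_inv c) (c z).
Proof.
move=> Ac Ac' dz dz'; apply: (smooth_differentiable (si.2 _ _ Ac Ac')).
by exists z.
Qed.

(** [dmap] is the matrix of the differential in the charts chosen at z and iota
    z; this turns it into the directional derivatives used below. *)
Lemma derive_dmap z u : 'D_u (chart_at (iota z) \o iota \o chart_inv (chart_at z))
  (chart_at z z) = u *m dmap iota z.
Proof.
apply: deriveEjacobian; apply: smooth_map_diff; do ?exact: atlas_chart_at.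
- exact: chart_at_dom.
- exact: chart_at_dom.
Qed.

(** Pulls eta back by means of any chart c of the target around iota z, instead
    of the chart chosen at iota z, which varies with z. *)
Lemma pullback_form (eta : M -> 'cV[R]_n) c z u : atlas c -> chart_dom c (iota z) ->
  form_app eta (iota z) (u *m dmap iota z) =
  ('D_u (c \o iota \o chart_inv (chart_at z)) (chart_at z z) *m
     coord_form c eta (c (iota z))) 0 0.
Proof.
move=> Ac dc; set r := iota z; set cz := chart_at z; set cr := chart_at r.
have Az : atlas cz := atlas_chart_at z; have Ar : atlas cr := atlas_chart_at r.
have dz : chart_dom cz z := chart_at_dom z.
have dr : chart_dom cr r := chart_at_dom r.
have N : \forall x \near cz z,
    ((c \o chart_inv cr) \o (cr \o iota \o chart_inv cz)) x = (c \o iota \o chart_inv cz) x.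
  have Nr : nbhs z (iota @^-1` (chart_dom cr)).
    apply: si.1; apply: open_nbhs_nbhs; split; first exact: chart_dom_open.
    exact: dr.
  have := near_chart dz Nr.
  apply: (@filterS _ _ (@nbhs_filter _ (cz z))) => x [q [dq dq'] ->] /=.
  by rewrite !chart_funK.
have d1 := smooth_map_diff Az Ar dz dr.
have Er : (cr \o iota \o chart_inv cz) (cz z) = cr r by rewrite /= chart_funK.
have d2 := transition_diff Ar Ac dr dc.
rewrite -Er in d2.
have -> : 'D_u (c \o iota \o chart_inv cz) (cz z) = u *m dmap iota z *m transition cr c r.
  apply: (etrans (esym (near_eq_derive u N))).
  apply: (etrans (derive_comp u d1 d2)).
  apply: (etrans (deriveEjacobian _ d2)).
  by rewrite Er (derive_dmap z u).
rewrite /coord_form chart_funK// mulmxA -[_ *m _ *m transition c _ _]mulmxA.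
by rewrite transition_comp// transition_id// mulmx1.
Qed.

End Dmap.

Section Slices.
Context {R : realType} (b k : nat) (V : normedModType R).

Lemma derive_row_mxr (f : 'rV[R]_(b + k) -> V) x y v :
  'D_(row_mx 0 v) f (row_mx x y) = 'D_v (fun y' => f (row_mx x y')) y.
Proof.
apply: eq_derive_along; apply: (@nearW _ (nbhs (0 : R))) => h.
by rewrite scale_row_mx add_row_mx scaler0 add0r.
Qed.

Lemma derive_row_mxl (f : 'rV[R]_(b + k) -> V) x y u :
  'D_(row_mx u 0) f (row_mx x y) = 'D_u (fun x' => f (row_mx x' y)) x.
Proof.
apply: eq_derive_along; apply: (@nearW _ (nbhs (0 : R))) => h.
by rewrite scale_row_mx add_row_mx scaler0 add0r.
Qed.

Lemma differentiable_row_mxl (y : 'rV[R]_k) (x : 'rV[R]_b) :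
  differentiable (fun x' : 'rV[R]_b => row_mx x' y) x.
Proof.
have -> : (fun x' : 'rV[R]_b => row_mx x' y) =
    (mulmxr (row_mx 1%:M 0) : 'rV[R]_b -> 'rV[R]_(b + k)) + cst (row_mx 0 y).
  apply/funext => x' /=; rewrite -[RHS]/(x' *m row_mx 1%:M 0 + row_mx 0 y).
  by rewrite mul_mx_row mulmx1 mulmx0 add_row_mx addr0 add0r.
apply: differentiableD; last exact: differentiable_cst.
exact/linear_differentiable/mulmxr_continuous.
Qed.

End Slices.

Section Mixed.
Context {R : realType} (b k n : nat) (B : @manifold R b) (F : @manifold R k) (M : @manifold R n).
Variable iota : prod_manifold B F -> M.
Hypothesis si : smooth_map iota.
Variable eta : M -> 'cV[R]_n.
Hypothesis se : form_smooth eta.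
Hypothesis cl : closed_form eta.

(** The pullback of eta on vectors tangent to the base and to the fibre. In each
    case the arguments put the variable along which it is differentiated last:
    here a point of the fibre, below a point of the base. *)
Definition fst_part (u : 'rV[R]_b) (p : B) (q : F) : R :=
  form_app eta (iota (p, q)) (row_mx u 0 *m dmap iota (p, q)).
Definition snd_part (v : 'rV[R]_k) (q : F) (p : B) : R :=
  form_app eta (iota (p, q)) (row_mx 0 v *m dmap iota (p, q)).

Hypothesis fst0 : forall u p q, fst_part u p q = 0.

(* The immersion in the chart c of the target and the charts of the two factors
   chosen at p and q. These three charts are kept while the points vary. *)
Let Y (c : chart n M) (p : B) (q : F) : 'rV[R]_(b + k) -> 'rV[R]_n :=
  c \o iota \o chart_inv (prod_chart (chart_at p) (chart_at q)).

(* The component along w of the pullback of eta, in those coordinates. *)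
Let G c p q w x : R^o := ('D_w (Y c p q) x *m coord_form c eta (Y c p q x)) 0 0.

Lemma Y_prod c p q p' q' : chart_dom (chart_at p) p' -> chart_dom (chart_at q) q' ->
  Y c p q (row_mx (chart_at p p') (chart_at q q')) = c (iota (p', q')).
Proof. by move=> dp dq; rewrite /Y /= row_mxKl row_mxKr !chart_funK. Qed.

(** Only the fibre coordinates vary in a derivative along the fibre, so it is
    the same for the base charts chosen at p and at p'. *)
Lemma G_snd c p q p' v : atlas c -> chart_dom (chart_at p) p' ->
  chart_dom c (iota (p', q)) ->
  G c p q (row_mx 0 v) (row_mx (chart_at p p') (chart_at q q)) = snd_part v q p'.
Proof.
move=> Ac dp dc; have dq := chart_at_dom q; have dp' := chart_at_dom p'.
apply: (etrans _ (esym (pullback_form si eta (row_mx 0 v) Ac dc))).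
rewrite /G (Y_prod c dp dq).
apply: (congr1 (fun A : 'rV[R]_n => (A *m coord_form c eta (c (iota (p', q)))) 0 0)).
rewrite -[chart_at ((p', q) : prod_manifold B F)]/(prod_chart (chart_at p') (chart_at q)).
rewrite -[prod_chart _ _ (p', q)]/(row_mx (chart_at p' p') (chart_at q q)).
rewrite [LHS]derive_row_mxr [RHS]derive_row_mxr.
apply: (congr1 (fun h : 'rV[R]_k -> 'rV[R]_n => 'D_v h (chart_at q q))).
apply/funext => y; rewrite /Y /= !row_mxKl !row_mxKr.
by rewrite !chart_funK.
Qed.

Lemma G_fst c p q q' u : atlas c -> chart_dom (chart_at q) q' ->
  chart_dom c (iota (p, q')) ->
  G c p q (row_mx u 0) (row_mx (chart_at p p) (chart_at q q')) = 0.
Proof.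
move=> Ac dq dc; have dp := chart_at_dom p; have dq' := chart_at_dom q'.
apply: (etrans _ (fst0 u p q')).
apply: (etrans _ (esym (pullback_form si eta (row_mx u 0) Ac dc))).
rewrite /G (Y_prod c dp dq).
apply: (congr1 (fun A : 'rV[R]_n => (A *m coord_form c eta (c (iota (p, q')))) 0 0)).
rewrite -[chart_at ((p, q') : prod_manifold B F)]/(prod_chart (chart_at p) (chart_at q')).
rewrite -[prod_chart _ _ (p, q')]/(row_mx (chart_at p p) (chart_at q' q')).
rewrite [LHS]derive_row_mxl [RHS]derive_row_mxl.
apply: (congr1 (fun h : 'rV[R]_b -> 'rV[R]_n => 'D_u h (chart_at p p))).
apply/funext => y; rewrite /Y /= !row_mxKl !row_mxKr.
by rewrite !chart_funK.
Qed.

Section AtPoint.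
Variables (p : B) (q : F).
Let c := chart_at (iota (p, q)).
Let Cp := chart_at p.
Let Cq := chart_at q.
Let x0 := row_mx (Cp p) (Cq q).
Let W := prod_chart Cp Cq @` (chart_dom (prod_chart Cp Cq) `&` iota @^-1` chart_dom c).

Let Ac : atlas c. Proof. exact: atlas_chart_at. Qed.
Let dc : chart_dom c (iota (p, q)). Proof. exact: chart_at_dom. Qed.
Let dCp : chart_dom Cp p. Proof. exact: chart_at_dom. Qed.
Let dCq : chart_dom Cq q. Proof. exact: chart_at_dom. Qed.

Let oW : open W.
Proof.
apply: chart_img_openI; apply: open_comp; last exact: chart_dom_open.
by move=> z _; exact: si.1.
Qed.

Let Wx0 : W x0.
Proof. by exists (p, q). Qed.

Let cY : Ck 2 W (Y c p q).
Proof. by apply: si.2 => //; exact: (@atlas_chart_at _ _ (prod_manifold B F) (p, q)). Qed.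

Let Yx0 : Y c p q x0 = c (iota (p, q)).
Proof. exact: Y_prod. Qed.

Let near_prod : exists2 UV : set B * set F, nbhs p UV.1 /\ nbhs q UV.2 &
  UV.1 `*` UV.2 `<=` iota @^-1` chart_dom c.
Proof.
have : nbhs (p, q) (iota @^-1` chart_dom c).
  apply: (si.1 (p, q)); apply: open_nbhs_nbhs; split; first exact: chart_dom_open.
  exact: dc.
by move=> [UV /= [U V] UVs]; exists UV.
Qed.

Let dE (w : 'rV[R]_n) :
  differentiable (fun y => (w *m coord_form c eta y) 0 0 : R^o) (Y c p q x0).
Proof. by rewrite Yx0; exact: coord_form_diff. Qed.

Let G_diff v : differentiable (G c p q (row_mx 0 v)) x0.
Proof.
have [dY DY] := cY.
exact: (differentiable_pairing dE (dY _ Wx0) ((DY _).1 _ Wx0)).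
Qed.

(* Closedness exchanges u and v, and the component along u is 0 on the whole
   fibre through (p, q). *)
Let G_derive u v : 'D_(row_mx u 0) (G c p q (row_mx 0 v)) x0 = 0.
Proof.
have clE (w w' : 'rV[R]_n) :
    'D_w (fun y => (w' *m coord_form c eta y) 0 0 : R^o) (Y c p q x0) =
    'D_w' (fun y => (w *m coord_form c eta y) 0 0 : R^o) (Y c p q x0).
  by rewrite Yx0; exact: cl.
apply: (etrans (pullback_closed (row_mx u 0) (row_mx 0 v) oW Wx0 cY dE clE)).
apply: (etrans (derive_row_mxr (G c p q (row_mx u 0)) (Cp p) (Cq q) v)).
apply: (etrans _ (derive_cst (0 : R^o) (Cq q) v)).
have [[U V] /= [nU nV] UV] := near_prod.
have N := near_chart dCq nV.
apply: near_eq_derive.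
apply: (@filterS _ _ (@nbhs_filter _ (Cq q))) N => y [q' [dq' Vq'] ->].
apply: G_fst => //; apply: (UV (p, q')); split => //=.
exact: nbhs_singleton.
Qed.

Let snd_part_near v : \forall x \near Cp p,
  G c p q (row_mx 0 v) (row_mx x (Cq q)) = (snd_part v q \o chart_inv Cp) x.
Proof.
have [[U V] /= [nU nV] UV] := near_prod.
have N := near_chart dCp nU.
apply: (@filterS _ _ (@nbhs_filter _ (Cp p))) N => y [p' [dp' Up'] ->].
rewrite /= chart_funK//; apply: G_snd => //; apply: (UV (p', q)); split => //=.
exact: nbhs_singleton.
Qed.

Lemma snd_part_diff v : differentiable (snd_part v q \o chart_inv Cp : _ -> R^o) (Cp p).
Proof.
apply: (near_eq_differentiable (snd_part_near v)).
apply: (@differentiable_comp _ _ _ _ (fun x => row_mx x (Cq q)) (G c p q (row_mx 0 v))).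
  exact: differentiable_row_mxl.
exact: G_diff.
Qed.

Lemma snd_part_derive v u : vderive (snd_part v q) p u = 0.
Proof.
apply: (etrans (esym (near_eq_derive u (snd_part_near v)))).
apply: (etrans (esym (derive_row_mxl (G c p q (row_mx 0 v)) (Cp p) (Cq q) u))).
exact: G_derive.
Qed.

End AtPoint.

(** The mixed part of the closedness of the pullback of eta gives a vanishing
    derivative in every base direction. *)
Lemma snd_part_const v q p p' : connected [set: B] -> snd_part v q p' = snd_part v q p.
Proof.
apply: connected_constant => [r|r u]; first exact: snd_part_diff.
exact: snd_part_derive.
Qed.

End Mixed.

(** Both sides are the derivative of iota along the same curve of the fibre. *)
Lemma snd_slice_tangent (R : realType) (b k n : nat) (B : @manifold R b) (F : @manifold R k)
    (M : @manifold R n) (iota : prod_manifold B F -> M) p q (v : 'rV[R]_k) :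
  smooth_map iota -> smooth_map (iota \o snd_slice p) ->
  v *m dmap (iota \o snd_slice p) q = row_mx 0 v *m dmap iota (p, q).
Proof.
move=> si sj; rewrite -(derive_dmap sj) -(derive_dmap si).
rewrite -[chart_at ((p, q) : prod_manifold B F)]/(prod_chart (chart_at p) (chart_at q)).
rewrite -[prod_chart _ _ (p, q)]/(row_mx (chart_at p p) (chart_at q q)).
rewrite [RHS]derive_row_mxr.
apply: (congr1 (fun h : 'rV[R]_k -> 'rV[R]_n => 'D_v h (chart_at q q))).
apply/funext => y /=; rewrite /= !row_mxKl !row_mxKr.
by rewrite chart_funK//; exact: chart_at_dom.
Qed.

Section Metric.
Context {R : realType} (m : nat) (M : @manifold R m.*2.+1).
Variables (phi : M -> 'M[R]_(m.*2.+1)) (xi : M -> 'rV[R]_(m.*2.+1))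
  (eta : M -> 'cV[R]_(m.*2.+1)) (g : M -> 'M[R]_(m.*2.+1)).
Hypothesis lap : lorentzian_almost_paracontact phi xi eta g.

(** The compatibility of g and phi at v = xi, where phi xi = 0 and
    eta xi = -1. *)
Lemma eta_metric r u : form_app eta r u = bil_app g r u (xi r).
Proof.
have := lap_compat lap r u (xi r).
rewrite (lap_phi_xi lap) (lap_eta_xi lap) /bil_app trmx0 mulmx0 mxE.
by move=> /eqP; rewrite mulrN1 eq_sym subr_eq0 => /eqP.
Qed.

End Metric.

(** * Nonexistence of the warped products *)

Theorem proposition4p3 (R : realType) (m : nat) (M : @manifold R m.*2.+1)
    (phi : M -> 'M[R]_(m.*2.+1)) (xi : M -> 'rV[R]_(m.*2.+1))
    (eta : M -> 'cV[R]_(m.*2.+1)) (g : M -> 'M[R]_(m.*2.+1)) :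
  lorentzian_paracosymplectic phi xi eta g ->
  ~ exists (b k : nat) (Mtheta : @manifold R b) (MT : @manifold R k)
      (gtheta : Mtheta -> 'M[R]_b) (gT : MT -> 'M[R]_k) (f : Mtheta -> R)
      (iota : prod_manifold Mtheta MT -> M)
      (DT Dtheta : prod_manifold Mtheta MT -> 'M[R]_(b + k))
      (theta : prod_manifold Mtheta MT -> R),
    [/\ connected [set: Mtheta],
        semi_slant_warped_product phi xi g gtheta gT f iota DT Dtheta theta,
        ~ (exists c : R, forall p, f p = c) &
        tangent_to_snd xi iota].
Proof.
move=> [lap [nabla [[_ tf _] pf _]]] [b [k [B [F [gB [gF [f [iota [DT [Dtheta [theta]]]]]]]]]]].
move=> [cB wp nf tg]; apply: nf.
have si : smooth_map iota.
  by have [[[]]] := sswp_semi_slant wp.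
have sj p : smooth_map (iota \o snd_slice p).
  by have [[[]]] := sswp_MT_invariant wp p.
have se := lap_eta_smooth lap.
have cl := parallel_form_closed tf pf se.
have [_ [q _]] := (mfd_nonempty B, mfd_nonempty F).
have xiE p q' : exists w : 'rV[R]_k, xi (iota (p, q')) = row_mx 0 w *m dmap iota (p, q').
  have /submxP[w ->] := tg p q'; exists w.
  exact: snd_slice_tangent.
have etaE p q' (w : 'rV[R]_k) u v : xi (iota (p, q')) = row_mx 0 w *m dmap iota (p, q') ->
    form_app eta (iota (p, q')) (row_mx u v *m dmap iota (p, q')) =
    f p ^+ 2 * (v *m gF q' *m w^T) 0 0.
  move=> xiw; rewrite (eta_metric lap) /bil_app xiw trmx_mul.
  have := sswp_isometric wp (p, q'); rewrite /induced_metric /warped_metric /= => I.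
  rewrite !mulmxA -[row_mx u v *m _ *m _]mulmxA -(mulmxA (row_mx u v)) I.
  rewrite tr_row_mx trmx0 mul_row_block !mulmx0 add0r addr0 mul_row_col mulmx0 add0r.
  by rewrite -scalemxAr -scalemxAl mxE.
(* The warped metric is block diagonal, so base vectors are orthogonal to xi. *)
have fst0 u p q' : fst_part iota eta u p q' = 0.
  have [w xiw] := xiE p q'.
  by rewrite /fst_part (etaE _ _ _ _ _ xiw) !mul0mx mxE mulr0.
have const v := snd_part_const si se cl fst0 v q.
have xi1 p (w : 'rV[R]_k) : xi (iota (p, q)) = row_mx 0 w *m dmap iota (p, q) ->
    snd_part iota eta w q p = -1.
  by move=> xiw; rewrite /snd_part -xiw (lap_eta_xi lap).
have [p0 _] := mfd_nonempty B.
exists (f p0) => p.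
have [w xiw] := xiE p q; have [w0 xiw0] := xiE p0 q.
(* The fibre component of xi at p is paired with xi at p0, and conversely;
   constancy along the base carries each pairing back to eta(xi) = -1. *)
have E0 : f p0 ^+ 2 * (w *m gF q *m w0^T) 0 0 = -1.
  by rewrite -(etaE _ _ _ 0 _ xiw0) -/(snd_part iota eta w q p0) (const w p p0 cB) (xi1 _ _ xiw).
have E1 : f p ^+ 2 * (w0 *m gF q *m w^T) 0 0 = -1.
  by rewrite -(etaE _ _ _ 0 _ xiw) -/(snd_part iota eta w0 q p) (const w0 p0 p cB) (xi1 _ _ xiw0).
have [nu _ [_ gFs _]] := sswp_gF wp.
have sym : (w *m gF q *m w0^T) 0 0 = (w0 *m gF q *m w^T) 0 0.
  transitivity ((w *m gF q *m w0^T)^T 0 0); first by rewrite [RHS]mxE.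
  by rewrite !trmx_mul trmxK gFs mulmxA.
rewrite sym -E1 in E0.
have s0 : (w0 *m gF q *m w^T) 0 0 != 0.
  by apply/eqP => s0; move: E1; rewrite s0 mulr0 => /eqP; rewrite eq_sym oppr_eq0 oner_eq0.
have /eqP := mulIf s0 E0.
by rewrite eqrXn2// ?ltW ?(sswp_f_gt0 wp)// => /eqP.
Qed.
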